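(* For every integer $k \geq 1$ and all integers $n \geq 1$, $$S_{2k}(n) = S_2(n) \sum_{r=1}^k b_{k,r} \big(S_1(n)\big)^{r-1} \quad\text{and}\quad S_{2k+1}(n) = \big(S_1(n)\big)^2 \sum_{r=1}^k c_{k,r} \big(S_1(n)\big)^{r-1},$$ where, for $r=1,2,\ldots,k$, $$b_{k,r} = \sum_{m=r}^k \frac{3\cdot 2^r}{(2m+1)!}\, R(k,m)\, Ps_m^{(r)}, \qquad c_{k,r} = \sum_{m=r}^k \frac{2^{r+1}}{(2m+2)!\,(m+1)}\, R(k+1,m+1)\, Ps_{m+1}^{(r+1)}.$$
   Context: For integers $k, n\ge 1$, $S_k(n) = 1^k + 2^k + \cdots + n^k$. For integers $0 \le m \le k$, the numbers $R(k,m)$ (OEIS A304330) are defined by $$R(k,m) = \sum_{j=0}^m (-1)^j \binom{2m}{j} (m-j)^{2k},$$ with the convention $0^0=1$. The (signed) Legendre-Stirling numbers of the first kind $Ps_m^{(r)}$, $1\le r\le m$ (OEIS A129467), are defined by the polynomial identity $$\prod_{j=0}^{m-1} \big(x - j(j+1)\big) = \sum_{r=1}^m Ps_m^{(r)} x^r .$$ *)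

(* Defs.v *)
From mathcomp Require Import all_boot all_order all_algebra.

Set Implicit Arguments.
Unset Strict Implicit.
Unset Printing Implicit Defensive.

Import GRing.Theory.
Local Open Scope ring_scope.

Definition power_sum (k n : nat) : nat := (\sum_(1 <= i < n.+1) i ^ k)%N.

(* OEIS A304330. The subtraction m - j is on nat, exact because j <= m;
   x ^+ 0 = 1 also for x = 0, as the convention 0^0 = 1 requires. *)
Definition numR (k m : nat) : int :=
  \sum_(0 <= j < m.+1)
    (-1) ^+ j * 'C(2 * m, j)%:R * (m - j)%N%:R ^+ (2 * k).

(* Signed Legendre-Stirling numbers of the first kind, OEIS A129467:
   Ps m r is the coefficient of x^r in prod_(j < m) (x - j (j + 1)). *)
Definition Ps (m r : nat) : int :=
  (\prod_(0 <= j < m) ('X - (j * (j + 1))%N%:R%:P) : {poly int})`_r.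

Lemma PsE (m : nat) : (0 < m)%N ->
  \prod_(0 <= j < m) ('X - (j * (j + 1))%N%:R%:P)
    = \sum_(1 <= r < m.+1) Ps m r *: 'X^r :> {poly int}.
Proof.
move=> m_gt0; rewrite /Ps; set p := \prod_(_ <= _ < _) _.
have sz_p : size p = m.+1.
  by rewrite /p size_prod_XsubC size_iota subn0.
rewrite -[LHS]coefK sz_p poly_def -(big_mkord predT (fun i => p`_i *: 'X^i)).
rewrite big_ltn //.
suff -> : p`_0 = 0 by rewrite scale0r add0r.
by rewrite -horner_coef0 /p big_ltn // hornerM hornerXsubC mul0n subr0 mul0r.
Qed.

Definition coef_b (k r : nat) : rat :=
  \sum_(r <= m < k.+1)
    3 * 2 ^+ r / ((2 * m + 1)`!)%:R * (numR k m)%:~R * (Ps m r)%:~R.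

Definition coef_c (k r : nat) : rat :=
  \sum_(r <= m < k.+1)
    2 ^+ (r + 1) / (((2 * m + 2)`!)%:R * (m + 1)%:R)
      * (numR (k + 1) (m + 1))%:~R * (Ps (m + 1) (r + 1))%:~R.

(* Main.v *)
Require Import Defs.
From mathcomp Require Import all_boot all_order all_algebra.
From mathcomp Require Import ring zify.

(** Both formulas come from expanding powers in a basis that telescopes.

    Write [x = n (n + 1) = 2 S_1(n)], [C_m(i) = prod_(j < m) (i^2 - j^2)] and
    [Q_m(x) = prod_(j < m) (x - j (j + 1))].  For [k >= 1], up to the factor
    [(2m)!/2], the numbers [R(k, m)] are the central factorial numbers, that is
    the coefficients of [i^(2k)] in the basis [C_m(i)]
    ([central_factorial_expansion]): this follows by induction on [k], since
    the recurrence [numR_rec] for [R] matches multiplication by [i^2] in this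
    basis ([square_poly_rec]).

    Substituting [i (i + 1)] and [(i - 1) i] in [Q_m] yields [C_m(i)] up to the
    factors [(i + m) / i] and [(i - m) / i], because
    [i (i + 1) - j (j + 1) = (i - j) (i + j + 1)].  Two suitable differences of
    such terms therefore telescope:
      [sum_(i <= n) C_m(i)     = (2n + 1) / (2 (2m + 1)) * Q_m(n (n + 1))],
      [sum_(i <= n) C_m(i) / i = 1 / (2m) * Q_m(n (n + 1))].
    They give [S_(2k)] and [S_(2k+1)] as combinations of the [Q_m(2 S_1)]
    ([sum_even_power], [sum_odd_power]).  Expanding [Q_m] in powers by means of
    the Legendre-Stirling numbers and exchanging the two summations gives the
    coefficients [b] and [c]; the factor [2n + 1] is absorbed by
    [3 S_2 = (2n + 1) S_1].

    In the odd case this produces a polynomial in [S_1] starting at degree 1,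
    whereas [S_1^2] has to factor out: the linear term must vanish.  Up to a
    constant it is the coefficient of [X] in the expansion of [X^(k+1)], which
    is zero for [k >= 1] ([sum_Ps_1_eq0]). *)

Set Implicit Arguments.
Unset Strict Implicit.
Unset Printing Implicit Defensive.
Import Order.TTheory GRing.Theory Num.Theory.
Local Open Scope ring_scope.

(** * Summation lemmas *)

Lemma sum_triangle_exchange (R : nmodType) (n : nat) (F : nat -> nat -> R) :
  \sum_(1 <= r < n.+1) \sum_(r <= m < n.+1) F r m
    = \sum_(1 <= m < n.+1) \sum_(1 <= r < m.+1) F r m.
Proof.
under eq_big_nat => r /andP[r_gt0 _].
  by rewrite (big_nat_widenl _ 1) //; over.
rewrite (exchange_big_dep_nat predT) //=.
apply: eq_big_nat => m /andP[_ le_mn].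
by rewrite [RHS](big_nat_widen _ _ n.+1) ?ltnS.
Qed.

Lemma alt_sum_binomial (n m : nat) :
  \sum_(0 <= j < m.+1) (-1) ^+ j * 'C(n.+1, j)%:R = (-1) ^+ m * 'C(n, m)%:R :> int.
Proof.
elim: m => [|m IHm]; first by rewrite big_nat1 !bin0.
by rewrite big_nat_recr //= IHm binS natrD !exprS; ring.
Qed.

(** * The numbers R(k, m) *)

Lemma mul_bin_inner (m j : nat) :
  ('C(2 * m.+1, j.+1) * j.+1 * (2 * m.+1 - j.+1)
    = 2 * m.+1 * (2 * m).+1 * 'C(2 * m, j))%N.
Proof.
have -> : (2 * m.+1 = (2 * m).+2)%N by lia.
rewrite subSS.
have h1 := mul_bin_diag (2 * m).+2 j; have h2 := mul_bin_down (2 * m).+1 j.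
rewrite /= in h1 h2.
rewrite (mulnC 'C(_, _)) -h1 -!mulnA; congr (_ * _)%N.
by rewrite mulnC -h2.
Qed.

(** Split one factor [(m+1-j)^2] of each summand as
    [(m+1)^2 - j (2(m+1) - j)]; the second part combines with the binomial to
    lower both [m] and [j] by one. *)
Lemma numR_rec (k m : nat) :
  numR k.+1 m.+1
    = (m.+1 ^ 2)%N%:R * numR k m.+1
      + (2 * m.+1 * (2 * m).+1)%N%:R * numR k m.
Proof.
have split_sq j : (j <= m.+1)%N ->
    (m.+1 - j)%N%:R ^+ 2 = (m.+1 ^ 2)%N%:R - (j * (2 * m.+1 - j))%N%:R :> int.
  move=> le_jm; rewrite natrM !natrB ?natrX ?natrM; [ring|lia|lia].
rewrite /numR.
under eq_big_nat => j /andP[_ le_jm].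
  rewrite (_ : (2 * k.+1 = 2 + 2 * k)%N); last by lia.
  rewrite exprD split_sq //.
  rewrite (_ : _ * _ =
      (m.+1 ^ 2)%N%:R
        * ((-1) ^+ j * 'C(2 * m.+1, j)%:R * (m.+1 - j)%N%:R ^+ (2 * k))
      - (-1) ^+ j * ('C(2 * m.+1, j) * j * (2 * m.+1 - j))%N%:R
        * (m.+1 - j)%N%:R ^+ (2 * k)); last by rewrite !natrM; ring.
  over.
rewrite sumrB -mulr_sumr; congr (_ + _).
rewrite big_nat_recl // muln0 mul0n mulr0 mul0r add0r.
rewrite -sumrN mulr_sumr; apply: eq_big_nat => j _.
by rewrite mul_bin_inner subSS natrM exprS; ring.
Qed.

(** The defining sum stops in the middle of the row of binomials, so it does
    not vanish when [k = 0]: by the symmetry of the row it is half of the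
    central term, up to sign. *)
Lemma numR_0l (m : nat) : numR 0 m.+1 * 2 = (-1) ^+ m.+1 * 'C(2 * m.+1, m.+1)%:R.
Proof.
rewrite /numR.
under eq_bigr do rewrite muln0 expr0 mulr1.
rewrite (_ : (2 * m.+1 = (2 * m).+2)%N); last by lia.
rewrite alt_sum_binomial mulr_natr mulr2n -mulrDr -natrD; congr (_ * _%:R).
rewrite [RHS]binS; congr (_ + _)%N.
rewrite -[RHS]bin_sub; last by lia.
by congr 'C(_, _); lia.
Qed.

Lemma numR_m0 (k : nat) : numR k.+1 0 = 0.
Proof. by rewrite /numR big_nat1 subnn expr0n mulr0. Qed.

Lemma numR_11 : numR 1 1 = 1.
Proof. by rewrite /numR big_nat_recr // big_nat1. Qed.

(** The recurrence propagates the vanishing from [k = 1] on, where it is a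
    cancellation between the two nonzero values at [k = 0]. *)
Lemma numR_small (k m : nat) : (k.+1 < m)%N -> numR k.+1 m = 0.
Proof.
elim: k m => [|k IHk] [//|m] lt_km; last first.
  by rewrite numR_rec !IHk ?mulr0 //; apply: ltnW.
case: m lt_km => // m _.
apply: (@mulIf _ 2) => //; rewrite mul0r.
rewrite numR_rec mulrDl -!mulrA !numR_0l.
have := mul_bin_inner m.+1 m.+1.
rewrite (_ : (2 * m.+2 - m.+2 = m.+2)%N); last by lia.
move/(congr1 (fun p : nat => p%:R : int)); rewrite !natrM => eq_bin.
rewrite exprS.
transitivity ((-1) ^+ m.+1 * (('C(2 * m.+2, m.+2)%:R * m.+2%:R * m.+2%:R) *- 1
   + 2 * m.+2%:R * (2 * m.+1).+1%:R * 'C(2 * m.+1, m.+1)%:R) :> int).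
  by ring.
by rewrite eq_bin; ring.
Qed.

(** * Central factorial expansion of even powers *)

(** For [k >= 1], the central factorial number usually written
    [T(2k, 2m)]. *)
Definition central_factorial (k m : nat) : rat :=
  2 * (numR k m)%:~R / ((2 * m)`!)%:R.

(** Its value at [i^2] is the central factorial polynomial
    [prod_(j < m) (i^2 - j^2)]; working in the variable [i^2] makes the linear
    coefficient used in [sum_Ps_1_eq0] directly accessible. *)
Definition square_poly (m : nat) : {poly rat} :=
  \prod_(0 <= j < m) ('X - (j ^ 2)%N%:R%:P).

(** The polynomial that defines [Ps m], over the rationals because the
    telescoped sums combine such polynomials with rational coefficients. *)
Definition oblong_poly (m : nat) : {poly rat} :=
  \prod_(0 <= j < m) ('X - (j * (j + 1))%N%:R%:P).

Lemma natr_fact_neq0 (i : nat) : i`!%:R != 0 :> rat.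
Proof. by rewrite pnatr_eq0 -lt0n fact_gt0. Qed.

Lemma central_factorial_rec (k m : nat) :
  central_factorial k.+1 m.+1
    = central_factorial k m + m.+1%:R ^+ 2 * central_factorial k m.+1.
Proof.
rewrite /central_factorial numR_rec (_ : (2 * m.+1 = (2 * m).+2)%N); last by lia.
rewrite !factS !natrM.
field.
by rewrite natr_fact_neq0 !lt0r_neq0 ?ltr_wpDr ?mulr_ge0 ?ler0n.
Qed.

Lemma square_poly_rec (m : nat) :
  'X * square_poly m = square_poly m.+1 + m%:R ^+ 2 *: square_poly m.
Proof.
rewrite /square_poly big_nat_recr //= natrX -mul_polyC; ring.
Qed.

(** Multiplying by ['X] acts on the basis by [square_poly_rec], which is the
    recurrence of the coefficients read the other way.  The shifts of index are
    harmless: the end terms that they add or drop contain the coefficient at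
    [m = 0] or [m = k + 2], or the factor [m^2] at [m = 0], all zero. *)
Lemma central_factorial_expansion (k : nat) :
  'X^(k.+1) = \sum_(1 <= m < k.+2) central_factorial k.+1 m *: square_poly m.
Proof.
elim: k => [|k IHk].
  rewrite big_nat1 /central_factorial /square_poly numR_11 big_nat1.
  by rewrite subr0 /= divff ?scale1r.
have sum0r (F : nat -> {poly rat}) : F 0%N = 0 ->
    \sum_(1 <= m < k.+2) F m = \sum_(0 <= m < k.+2) F m.
  by move=> F0; rewrite [RHS]big_ltn // F0 add0r.
have sumSr (F : nat -> {poly rat}) : F 0%N = 0 -> F k.+2 = 0 ->
    \sum_(1 <= m < k.+2) F m = \sum_(0 <= m < k.+2) F m.+1.
  move=> F0 Fk.
  by rewrite [RHS]big_nat_recr //= Fk addr0 big_add1.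
rewrite exprS IHk mulr_sumr [RHS]big_add1 /=.
under [RHS]eq_bigr do rewrite central_factorial_rec scalerDl.
under eq_bigr do rewrite -scalerAr square_poly_rec scalerDr.
rewrite !big_split /=; congr (_ + _).
  apply: sum0r; by rewrite /central_factorial numR_m0 mulr0 mul0r scale0r.
under eq_bigr do rewrite scalerA mulrC.
apply: (sumSr (fun m => (m%:R ^+ 2 * central_factorial k.+1 m) *: square_poly m)).
  by rewrite expr0n mul0r scale0r.
by rewrite /central_factorial numR_small // mulr0 mul0r mulr0 scale0r.
Qed.

(** * Telescoping *)

Lemma horner_square_poly (m : nat) (x : rat) :
  (square_poly m).[x ^+ 2] = \prod_(0 <= j < m) (x ^+ 2 - j%:R ^+ 2).
Proof. by rewrite horner_prod; apply: eq_bigr => j _; rewrite hornerXsubC natrX. Qed.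

Lemma horner_oblong_poly (m : nat) (x : rat) :
  (oblong_poly m).[x * (x + 1)]
    = \prod_(0 <= j < m) ((x - j%:R) * (x + j%:R + 1)).
Proof.
rewrite horner_prod; apply: eq_bigr => j _.
by rewrite hornerXsubC natrM natrD; ring.
Qed.

(** Both products have the factors [x - j]; the remaining quotient
    [prod (x + j + 1) / (x + j)] collapses to [(x + m) / x]. The next lemma is
    the mirror image, with the factors [x + j] in common. *)
Lemma mul_oblong_poly_succ (m : nat) (x : rat) :
  x * (oblong_poly m).[x * (x + 1)] = (x + m%:R) * (square_poly m).[x ^+ 2].
Proof.
rewrite horner_oblong_poly horner_square_poly.
elim: m => [|m IHm]; first by rewrite !big_geq //; ring.
rewrite !big_nat_recr //= mulrA IHm; ring.
Qed.

Lemma mul_oblong_poly_pred (m : nat) (x : rat) :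
  x * (oblong_poly m).[(x - 1) * x] = (x - m%:R) * (square_poly m).[x ^+ 2].
Proof.
rewrite -{3}(subrK 1 x) horner_oblong_poly horner_square_poly.
elim: m => [|m IHm]; first by rewrite !big_geq //; ring.
rewrite !big_nat_recr //= mulrA IHm; ring.
Qed.

Lemma oblong_poly_at0 (m : nat) : (0 < m)%N -> (oblong_poly m).[0] = 0.
Proof.
move=> m_gt0.
by rewrite /oblong_poly big_ltn // hornerM hornerXsubC subr0 mul0r.
Qed.

(** Weighting [Q_m(i (i + 1))] by [2i + 1] makes the difference of consecutive
    values proportional to [C_m(i)], since
    [(2i + 1) (i + m) - (2i - 1) (i - m) = 2 i (2m + 1)]. *)
Lemma sum_even_power (k n : nat) :
  (power_sum (2 * k.+1) n)%:R
    = \sum_(1 <= m < k.+2) central_factorial k.+1 m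
        * ((2 * n + 1)%:R / (2 * (2 * m + 1)%:R)
           * (oblong_poly m).[n%:R * (n%:R + 1)]) :> rat.
Proof.
pose G (m i : nat) : rat :=
  (2 * i%:R + 1) / (2 * (2 * m + 1)%:R) * (oblong_poly m).[i%:R * (i%:R + 1)].
have GD m i : (square_poly m).[i.+1%:R ^+ 2] = G m i.+1 - G m i.
  have i_n0 : i.+1%:R != 0 :> rat by rewrite pnatr_eq0.
  have m_n0 : (2 * m + 1)%:R != 0 :> rat by rewrite pnatr_eq0 addn1.
  apply: (mulfI i_n0); rewrite mulrBr /G.
  have h1 := mul_oblong_poly_succ m i.+1%:R.
  have h2 := mul_oblong_poly_pred m i.+1%:R.
  rewrite !(mulrCA i.+1%:R) h1.
  have -> : i%:R * (i%:R + 1) = (i.+1%:R - 1) * i.+1%:R :> rat.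
    by rewrite -natr1; ring.
  rewrite h2; rewrite natrD natrM in m_n0 *.
  rewrite -natr1; field; exact: m_n0.
rewrite /power_sum natr_sum big_add1 /=.
under eq_bigr => i _.
  rewrite natrX exprM -hornerXn central_factorial_expansion horner_sum.
  under eq_big_nat => m hm do rewrite hornerZ GD.
  over.
rewrite exchange_big_nat /=; apply: eq_big_nat => m /andP[m_gt0 _].
rewrite -mulr_sumr telescope_sumr // /G.
rewrite [in X in _ - X]mul0r oblong_poly_at0 // mulr0 subr0.
by rewrite (natrD _ (2 * n)) (natrM _ 2 n).
Qed.

(** Without a weight the difference of consecutive values of [Q_m(i (i + 1))] is
    [2 m C_m(i) / i], so that the expansion of [i^(2k+2)] divided by [i]
    telescopes. *)
Lemma sum_odd_power (k n : nat) :
  (power_sum (2 * k + 1) n)%:R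
    = \sum_(1 <= m < k.+2) central_factorial k.+1 m
        * ((2 * m%:R)^-1 * (oblong_poly m).[n%:R * (n%:R + 1)]) :> rat.
Proof.
pose G (m i : nat) : rat := (2 * m%:R)^-1 * (oblong_poly m).[i%:R * (i%:R + 1)].
have GD m i : (0 < m)%N ->
    (square_poly m).[i.+1%:R ^+ 2] = i.+1%:R * (G m i.+1 - G m i).
  move=> m_gt0; have m_n0 : m%:R != 0 :> rat by rewrite pnatr_eq0 -lt0n.
  rewrite mulrBr /G.
  have h1 := mul_oblong_poly_succ m i.+1%:R.
  have h2 := mul_oblong_poly_pred m i.+1%:R.
  rewrite !(mulrCA i.+1%:R) h1.
  have -> : i%:R * (i%:R + 1) = (i.+1%:R - 1) * i.+1%:R :> rat.
    by rewrite -natr1; ring.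
  by rewrite h2; field.
rewrite /power_sum natr_sum big_add1 /=.
under eq_bigr => i _.
  have i_n0 : i.+1%:R != 0 :> rat by rewrite pnatr_eq0.
  rewrite (_ : _%:R =
      \sum_(1 <= m < k.+2) central_factorial k.+1 m * (G m i.+1 - G m i)).
    over.
  apply: (mulfI i_n0).
  rewrite -natrM -expnS (_ : (2 * k + 1).+1 = 2 * k.+1)%N; last by lia.
  rewrite natrX exprM -hornerXn central_factorial_expansion horner_sum mulr_sumr.
  by apply: eq_big_nat => m /andP[m_gt0 _]; rewrite hornerZ GD // mulrCA.
rewrite exchange_big_nat /=; apply: eq_big_nat => m /andP[m_gt0 _].
rewrite -mulr_sumr telescope_sumr // /G.
by rewrite [in X in _ - X]mul0r oblong_poly_at0 // mulr0 subr0.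
Qed.

(** * Legendre-Stirling numbers *)

Lemma oblong_poly_Ps (m : nat) (x : rat) : (0 < m)%N ->
  (oblong_poly m).[x] = \sum_(1 <= r < m.+1) (Ps m r)%:~R * x ^+ r.
Proof.
move=> m_gt0.
have -> : oblong_poly m = map_poly intr
   (\prod_(0 <= j < m) ('X - (j * (j + 1))%N%:R%:P) : {poly int}).
  rewrite rmorph_prod; apply: eq_bigr => j _.
  by rewrite rmorphB /= map_polyX map_polyC /= !rmorph_nat.
rewrite PsE // rmorph_sum horner_sum; apply: eq_bigr => r _.
by rewrite /= map_polyZ hornerZ map_polyXn hornerXn.
Qed.

Lemma coef1_prod_XsubC (R : comNzRingType) (a : nat -> R) (m : nat) : a 0%N = 0 ->
  (\prod_(0 <= j < m.+1) ('X - (a j)%:P))`_1 = \prod_(0 <= j < m) (- a j.+1).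
Proof.
move=> a0; rewrite big_nat_recl // a0 subr0 coefXM /=.
rewrite -horner_coef0 horner_prod; apply: eq_bigr => j _.
by rewrite hornerXsubC sub0r.
Qed.

(** Both linear coefficients are signed products, and
    [j (j + 1)] differs from [j^2] by a factor [(j + 1) / j] whose product
    telescopes to [m]. *)
Lemma Ps_1 (m : nat) : (0 < m)%N -> (Ps m 1)%:~R = m%:R * (square_poly m)`_1 :> rat.
Proof.
case: m => // m _; rewrite /Ps /square_poly !coef1_prod_XsubC //.
elim: m => [|m IHm]; first by rewrite !big_geq.
rewrite !big_nat_recr //= intrM IHm.
by rewrite natrX !natrM ?natrD; ring.
Qed.

(** By [Ps_1] the sum is half of the coefficient of ['X] in the expansion of
    ['X^(k+1)]. *)
Lemma sum_Ps_1_eq0 (k : nat) : (0 < k)%N ->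
  \sum_(1 <= m < k.+2) central_factorial k.+1 m * ((2 * m%:R)^-1 * (Ps m 1)%:~R) = 0.
Proof.
move=> k_gt0; apply: (@mulfI _ 2) => //; rewrite mulr0 mulr_sumr.
have := congr1 (fun p : {poly rat} => p`_1) (central_factorial_expansion k).
rewrite /= coefXn eqSS eq_sym (gtn_eqF k_gt0) coef_sum /= mulr0n => coef1_eq0.
rewrite [RHS]coef1_eq0.
apply: eq_big_nat => m /andP[m_gt0 _].
rewrite coefZ Ps_1 //; field.
by rewrite pnatr_eq0 -lt0n.
Qed.

(** * Power sums as polynomials in S_1 *)

Lemma natr_power_sum_1 (n : nat) :
  n%:R * (n%:R + 1) = 2 * (power_sum 1 n)%:R :> rat.
Proof.
have := sum_odd_power 0 n; rewrite muln0 add0n => ->.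
rewrite big_nat1 /central_factorial numR_11 /oblong_poly big_nat1 hornerXsubC.
by rewrite (_ : (2 * 1)`! = 2)%N // mul0n mulr0n; field.
Qed.

Lemma natr_power_sum_2 (n : nat) :
  3 * (power_sum 2 n)%:R = (2 * n + 1)%:R * (power_sum 1 n)%:R :> rat.
Proof.
have := sum_even_power 0 n; rewrite muln1 => ->.
rewrite big_nat1 /central_factorial numR_11 /oblong_poly big_nat1 hornerXsubC.
by rewrite (natr_power_sum_1 n) (_ : (2 * 1)`! = 2)%N // mul0n mulr0n; field.
Qed.

Theorem proposition12 (k n : nat) (hk : (1 <= k)%N) (hn : (1 <= n)%N) :
  (power_sum (2 * k) n)%:R
    = (power_sum 2 n)%:R
      * \sum_(1 <= r < k.+1) coef_b k r * (power_sum 1 n)%:R ^+ (r - 1) :> rat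
  /\
  (power_sum (2 * k + 1) n)%:R
    = (power_sum 1 n)%:R ^+ 2
      * \sum_(1 <= r < k.+1) coef_c k r * (power_sum 1 n)%:R ^+ (r - 1) :> rat.
Proof.
split.
  case: k hk => // k _; rewrite sum_even_power natr_power_sum_1.
  set S := (power_sum 1 n)%:R.
  apply: (@mulfI _ 3) => //; rewrite mulrA natr_power_sum_2 -/S.
  under [in RHS]eq_bigr do rewrite /coef_b mulr_suml.
  rewrite sum_triangle_exchange !mulr_sumr.
  apply: eq_big_nat => m /andP[m_gt0 _].
  rewrite oblong_poly_Ps // !mulr_sumr; apply: eq_big_nat => -[//|r] _.
  rewrite /central_factorial (addn1 (2 * m)) factS !natrM exprMn subn1 !exprS /=.
  field.
  by rewrite natr_fact_neq0 lt0r_neq0 ?ltr_wpDr ?mulr_ge0 ?ler0n.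
rewrite sum_odd_power natr_power_sum_1.
set S := (power_sum 1 n)%:R.
under [in RHS]eq_bigr do rewrite /coef_c mulr_suml.
rewrite sum_triangle_exchange.
(* Isolate the linear terms, whose total vanishes. *)
rewrite (eq_big_nat _ _ (F2 := fun m =>
  central_factorial k.+1 m * ((2 * m%:R)^-1 * (Ps m 1)%:~R) * (2 * S)
  + central_factorial k.+1 m * (2 * m%:R)^-1
    * \sum_(2 <= r < m.+1) (Ps m r)%:~R * (2 * S) ^+ r)); last first.
  move=> m /andP[m_gt0 _]; rewrite oblong_poly_Ps // big_ltn // expr1; ring.
rewrite big_split /= -mulr_suml sum_Ps_1_eq0 // mul0r add0r.
(* The summand at [m = 1] has no term of degree 2 or more; shift [m] and [r]. *)
rewrite big_ltn // (big_geq (leqnn 2)) mulr0 add0r big_add1 mulr_sumr.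
apply: eq_big_nat => m /andP[m_gt0 _].
rewrite big_add1 !mulr_sumr; apply: eq_big_nat => -[//|r] _.
rewrite /central_factorial subn1 exprMn !addn1 mulnS add2n addn2 !exprS /=.
field.
by rewrite natr_fact_neq0 andbT lt0r_neq0 ?ltr_wpDr ?ler0n.
Qed.
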